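(* Let $f(x_1,x_2,y_1,y_2)=x_2$ on $\mathbb{R}^4$, let $J$ be the almost complex structure on $\mathbb{R}^4$ given by $$J\frac{\partial}{\partial x_1}=f\frac{\partial}{\partial x_2}+\frac{\partial}{\partial y_1},\quad J\frac{\partial}{\partial x_2}=\frac{\partial}{\partial y_2},\quad J\frac{\partial}{\partial y_1}=-\frac{\partial}{\partial x_1}-f\frac{\partial}{\partial y_2},\quad J\frac{\partial}{\partial y_2}=-\frac{\partial}{\partial x_2},$$ and let $g_J$ be a $J$-Hermitian metric on $\mathbb{R}^4$. Let $$\beta = dx_1\wedge dx_2-f\,dx_1\wedge dy_1- dy_1\wedge dy_2,\qquad \gamma = dx_1\wedge dy_2-dx_2\wedge dy_1 .$$ Then: (I) $J$ is a non-integrable almost complex structure on $\mathbb{R}^4$. (II) For every pair $(s,t)\in\mathbb{R}^2$ such that $s^2+t^2+t=0$, the form $$\alpha_{s,t}=te^{sx_1+ty_1}\beta - se^{sx_1+ty_1}\gamma$$ is $J$-anti-invariant and closed. Therefore, the space $\mathcal{H}^-_{J}(\mathbb{R}^4)$ of $J$-anti-invariant $g_J$-harmonic $2$-forms on $\mathbb{R}^4$ has infinite dimension.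
   Context: Coordinates on $\mathbb{R}^4$ are $(x_1,x_2,y_1,y_2)$; forms are smooth and real. For an almost complex structure $J$ on a manifold $M$ (a smooth $(1,1)$-tensor field with $J^2=-\mathrm{id}$), a $2$-form $\alpha$ is $J$-anti-invariant if $\alpha(JX,JY)=-\alpha(X,Y)$ for all vector fields $X,Y$. $J$ is integrable if its Nijenhuis tensor $N_J(X,Y)=[JX,JY]-[X,Y]-J[JX,Y]-J[X,JY]$ vanishes identically, and non-integrable otherwise. A $J$-Hermitian metric is a Riemannian metric $g_J$ with $g_J(JX,JY)=g_J(X,Y)$. $\mathcal{H}^-_J(M)$ denotes the real vector space of $J$-anti-invariant $2$-forms $\alpha$ with $\Delta_{g_J}\alpha=0$, where $\Delta_{g_J}$ is the Hodge Laplacian of $g_J$. *)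

(* Defs.v *)
From HB Require Import structures.
From mathcomp Require Import all_boot all_order all_algebra.
From mathcomp Require Import all_classical all_reals all_analysis.
Set Implicit Arguments.
Unset Strict Implicit.
Unset Printing Implicit Defensive.
Import Order.TTheory GRing.Theory Num.Theory.
Import numFieldNormedType.Exports.
Local Open Scope classical_set_scope.
Local Open Scope ring_scope.

Section EuclideanSpace.
Variables (R : realType) (n : nat).
Local Notation E := 'rV[R]_n.

(* C^k: [f] is Frechet differentiable and all its directional derivatives,
   along constant vectors, are C^(k-1). *)
Fixpoint Ck (k : nat) (f : E -> R) : Prop :=
  if k is k'.+1
  then (forall x, differentiable f x) /\ (forall v, Ck k' (fun x => 'D_v f x))
  else continuous f.

Definition smooth (f : E -> R) : Prop := forall k, Ck k f.

Definition smooth_mx m p (A : E -> 'M[R]_(m, p)) : Prop :=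
  forall i j, smooth (fun x => A x i j).

(* All tangent spaces are identified with E.  A (1,1)-tensor field J acts on
   row vectors by right multiplication: J_x v = v *m J x, so row i of J x is the
   image of the i-th coordinate vector field. *)
Definition tensor11 := E -> 'M[R]_n.

Definition almost_complex (J : tensor11) : Prop :=
  smooth_mx J /\ forall x, J x *m J x = - 1%:M.

Definition J_field (J : tensor11) (X : E -> E) : E -> E := fun x => X x *m J x.

Definition lie_bracket (X Y : E -> E) : E -> E :=
  fun x => 'D_(X x) Y x - 'D_(Y x) X x.

Definition nijenhuis (J : tensor11) (X Y : E -> E) : E -> E :=
  fun x => lie_bracket (J_field J X) (J_field J Y) x - lie_bracket X Y x
           - J_field J (lie_bracket (J_field J X) Y) x
           - J_field J (lie_bracket X (J_field J Y)) x.

Definition integrable_acs (J : tensor11) : Prop :=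
  forall X Y : E -> E, smooth_mx X -> smooth_mx Y ->
  forall x, nijenhuis J X Y x = 0.

(* A metric is given by its Gram matrices in the coordinate frame. *)
Definition inner (g : E -> 'M[R]_n) (x u v : E) : R :=
  (u *m g x *m v^T) ord0 ord0.

Definition riemannian (g : E -> 'M[R]_n) : Prop :=
  [/\ smooth_mx g, (forall x, (g x)^T = g x)
    & forall x u, u != 0 -> 0 < inner g x u u].

Definition hermitian_metric (J : tensor11) (g : E -> 'M[R]_n) : Prop :=
  riemannian g /\
  forall x u v, inner g x (u *m J x) (v *m J x) = inner g x u v.

(* A k-form w is evaluated at a point x on k tangent vectors, given as the rows
   of a k x n matrix. *)
Definition kform (k : nat) := E -> 'M[R]_(k, n) -> R.

Definition multilinear_rows k (a : 'M[R]_(k, n) -> R) : Prop :=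
  forall (A B C : 'M[R]_(k, n)) i b c,
    row i A = b *: row i B + c *: row i C ->
    row' i B = row' i A -> row' i C = row' i A ->
    a A = b * a B + c * a C.

Definition alternating_rows k (a : 'M[R]_(k, n) -> R) : Prop :=
  forall (A : 'M[R]_(k, n)) i j, i != j -> row i A = row j A -> a A = 0.

Definition diff_form k (w : kform k) : Prop :=
  [/\ forall x, multilinear_rows (w x), forall x, alternating_rows (w x)
    & forall M, smooth (fun x => w x M)].

Definition ext_d k (w : kform k) : kform k.+1 :=
  fun x M => \sum_(i < k.+1)
    (-1) ^+ i * 'D_(row i M) (fun z => w z (row' i M)) x.

Definition closed_form k (w : kform k) : Prop := ext_d w = 0.

Definition dcoord (i : 'I_n) : kform 1 := fun _ M => M ord0 i.

Definition wedge11 (a b : kform 1) : kform 2 :=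
  fun x M => a x (row ord0 M) * b x (row ord_max M)
             - a x (row ord_max M) * b x (row ord0 M).

Definition fmul k (h : E -> R) (w : kform k) : kform k := fun x M => h x * w x M.

(* Hodge star for the orientation dx_1 /\ ... /\ dx_n:
     ( *w)_{j_1..j_m} = 1/k! sqrt(det g) w^{i_1..i_k} eps_{i_1..i_k j_1..j_m}.
   The rows of [rowsub I (invmx (g x))] are the vectors g^{i_a l} e_l, so that
   evaluating w on them raises its indices; eps is the determinant. *)
Definition hodge_star (g : E -> 'M[R]_n) k m (e : (k + m)%N = n) (w : kform k) :
    kform m :=
  fun x M => (k`!%:R)^-1 * Num.sqrt (\det (g x)) *
    \sum_(I : {ffun 'I_k -> 'I_n})
      w x (rowsub I (invmx (g x))) *
      \det (castmx (e, erefl n) (col_mx (rowsub I 1%:M) M)).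

(* delta = (-1)^(n(p+1)+1) * d * on p-forms, here with p = k.+1. *)
Definition codiff (g : E -> 'M[R]_n) k m
    (e : (k.+1 + m)%N = n) (e' : (m.+1 + k)%N = n) (w : kform k.+1) : kform k :=
  (-1) ^+ (n * k.+2 + 1)%N *: hodge_star g e' (ext_d (hodge_star g e w)).

Definition J_anti_invariant (J : tensor11) (w : kform 2) : Prop :=
  forall x M, w x (M *m J x) = - w x M.

End EuclideanSpace.

Definition finite_dimensional (R : realType) (V : lmodType R) (H : set V) : Prop :=
  exists m (b : 'I_m -> V), (forall i, H (b i)) /\
    forall a, H a -> exists c : 'I_m -> R, a = \sum_i c i *: b i.

Section R4.
Variable R : realType.
Local Notation E := 'rV[R]_4.

Definition laplacian2 (g : E -> 'M[R]_4) (w : kform R 4 2) : kform R 4 2 :=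
  ext_d (@codiff R 4 g 1 2 erefl erefl w) + @codiff R 4 g 2 1 erefl erefl (ext_d w).

Definition harmonic_anti_invariant (J : tensor11 R 4) (g : E -> 'M[R]_4) :
    set (kform R 4 2) :=
  [set w | [/\ diff_form w, J_anti_invariant J w & laplacian2 g w = 0]].

Definition ix1 : 'I_4 := @Ordinal 4 0 isT.
Definition ix2 : 'I_4 := @Ordinal 4 1 isT.
Definition iy1 : 'I_4 := @Ordinal 4 2 isT.
Definition iy2 : 'I_4 := @Ordinal 4 3 isT.

Definition xcoord (i : 'I_4) : E -> R := fun p => p ord0 i.
Definition xpartial (i : 'I_4) : E := delta_mx ord0 i.

Definition J4 (f : E -> R) : tensor11 R 4 := fun p =>
  \matrix_(i < 4) nth 0
    [:: f p *: xpartial ix2 + xpartial iy1;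
        xpartial iy2;
        - xpartial ix1 - f p *: xpartial iy2;
        - xpartial ix2] i.

Definition dd (i j : 'I_4) : kform R 4 2 := wedge11 (@dcoord R 4 i) (@dcoord R 4 j).

Definition beta_form (f : E -> R) : kform R 4 2 :=
  dd ix1 ix2 - fmul f (dd ix1 iy1) - dd iy1 iy2.

Definition gamma_form : kform R 4 2 := dd ix1 iy2 - dd ix2 iy1.

Definition alpha_form (f : E -> R) (s t : R) : kform R 4 2 :=
  let h := fun p => expR (s * xcoord ix1 p + t * xcoord iy1 p) in
  fmul (fun p => t * h p) (beta_form f) - fmul (fun p => s * h p) gamma_form.

End R4.

(* Main.v *)
Require Import Defs.
From mathcomp Require Import all_boot all_order all_algebra.
From mathcomp Require Import all_classical all_reals all_analysis.
From mathcomp Require Import ring lra.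
Local Open Scope ring_scope.

(** The structure is not integrable because the coefficient [f = x_2] varies in
    the direction x_2: for X = d/dx_1 and Y = d/dx_2 the only nonzero term of
    the Nijenhuis tensor is -J[JX, Y] = -J(-d/dx_2) = d/dy_2.

    The J-anti-invariance of beta and gamma is a pointwise identity.  The form
    alpha_{s,t} is closed because, with h = exp(s x_1 + t y_1),
      d(t h beta - s h gamma) = (s^2 + t^2 + t) h dx_1 /\ dx_2 /\ dy_1;
    the summand t comes from d beta = dx_1 /\ dx_2 /\ dy_1.

    On an almost Hermitian 4-manifold a J-anti-invariant 2-form is self-dual for
    the orientation given by J, whatever the Hermitian metric is.  Here J induces
    the orientation opposite to dx_1 /\ dx_2 /\ dy_1 /\ dy_2, so the Hodge star
    acts on such forms as -1 ([hodge_star_pform]); hence a closed one is also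
    co-closed, and harmonic ([closed_antiselfdual_harmonic]).  To prove the
    duality, J g J^T = g is solved for g: the solutions form a family with four
    parameters a, b, c, d ([hermitian_gram]), the two real diagonal and one
    complex off-diagonal entries of a Hermitian 2 x 2 matrix.  The determinant
    D = a d - b^2 - c^2 of that matrix satisfies det g = D^2, and duality becomes
    the polynomial identity [gram_dual].

    Finally, the circle s^2 + t^2 + t = 0 has infinitely many points, and the
    corresponding forms are linearly independent: evaluated on d/dy_1, d/dy_2 at
    the points y_1 = 0, 1, ..., m, with the other coordinates 0, the forms with
    parameters t_0, ..., t_m give the matrix -t_i exp(t_i)^j, a diagonal matrix
    times a Vandermonde matrix.  In a space spanned by m vectors that (m+1) x
    (m+1) determinant would vanish ([det_evaluation_finite_dimensional]). *)

Set Implicit Arguments.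
Unset Strict Implicit.
Unset Printing Implicit Defensive.
Import Order.TTheory GRing.Theory Num.Theory.
Import numFieldNormedType.Exports.

(** * Matrices of size 4 *)

Lemma ord2P (P : 'I_2 -> Prop) : P ord0 -> P ord_max -> forall i, P i.
Proof.
move=> P0 P1 i; case: (unliftP ord_max i) => [j|] -> //.
by rewrite ord1 (_ : lift ord_max 0 = ord0) //; apply: val_inj.
Qed.

Lemma ord4P (P : 'I_4 -> Prop) :
  P ix1 -> P ix2 -> P iy1 -> P iy2 -> forall i, P i.
Proof.
move=> P1 P2 P3 P4 [] [|[|[|[|//]]]] lt4.
- by rewrite (_ : Ordinal lt4 = ix1) //; apply: val_inj.
- by rewrite (_ : Ordinal lt4 = ix2) //; apply: val_inj.
- by rewrite (_ : Ordinal lt4 = iy1) //; apply: val_inj.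
- by rewrite (_ : Ordinal lt4 = iy2) //; apply: val_inj.
Qed.

Lemma sum4E (V : nmodType) (F : 'I_4 -> V) :
  \sum_i F i = F ix1 + F ix2 + F iy1 + F iy2.
Proof.
rewrite !big_ord_recl big_ord0 addr0 !addrA.
by congr (F _ + F _ + F _ + F _); apply: val_inj.
Qed.

Section Matrices.
Variable R : comNzRingType.

Definition mx4 (s : seq (seq R)) : 'M[R]_4 :=
  \matrix_(i, j) nth 0 (nth [::] s i) j.

Lemma mulmx4E m n (A : 'M[R]_(m, 4)) (B : 'M[R]_(4, n)) i j :
  (A *m B) i j =
  A i ix1 * B ix1 j + A i ix2 * B ix2 j + A i iy1 * B iy1 j + A i iy2 * B iy2 j.
Proof. by rewrite mxE sum4E. Qed.

(** Laplace expansion along the first two rows: in this form the coefficients of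
    the lower 2 x 2 minors can be read off. *)
Lemma det4E (B : 'M[R]_4) (b := fun i j : 'I_4 => B i j) :
  \det B =
    (b ix1 ix1 * b ix2 ix2 - b ix1 ix2 * b ix2 ix1)
      * (b iy1 iy1 * b iy2 iy2 - b iy1 iy2 * b iy2 iy1)
  - (b ix1 ix1 * b ix2 iy1 - b ix1 iy1 * b ix2 ix1)
      * (b iy1 ix2 * b iy2 iy2 - b iy1 iy2 * b iy2 ix2)
  + (b ix1 ix1 * b ix2 iy2 - b ix1 iy2 * b ix2 ix1)
      * (b iy1 ix2 * b iy2 iy1 - b iy1 iy1 * b iy2 ix2)
  + (b ix1 ix2 * b ix2 iy1 - b ix1 iy1 * b ix2 ix2)
      * (b iy1 ix1 * b iy2 iy2 - b iy1 iy2 * b iy2 ix1)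
  - (b ix1 ix2 * b ix2 iy2 - b ix1 iy2 * b ix2 ix2)
      * (b iy1 ix1 * b iy2 iy1 - b iy1 iy1 * b iy2 ix1)
  + (b ix1 iy1 * b ix2 iy2 - b ix1 iy2 * b ix2 iy1)
      * (b iy1 ix1 * b iy2 ix2 - b iy1 ix2 * b iy2 ix1).
Proof.
(* Indices are turned into natural numbers, so that the ordinals produced by
   the cofactors compute to the same terms as those of the statement. *)
pose N i j := B (inord i) (inord j).
have BN (i j : 'I_4) : B i j = N i j by rewrite /N !inord_val.
rewrite /b !BN.
rewrite (expand_det_row _ ord0) !big_ord_recl big_ord0 /cofactor.
rewrite !(expand_det_row _ ord0) !big_ord_recl !big_ord0 /cofactor.
rewrite !(expand_det_row _ ord0) !big_ord_recl !big_ord0 /cofactor.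
by rewrite !det_mx11 !mxE !BN /= /bump /=; ring.
Qed.

End Matrices.

(** * Smoothness and derivatives of the coefficients *)

Section Coefficients.
Variable R : realType.
Local Notation E := 'rV[R]_4.

Lemma is_diff_xcoord (i : 'I_4) (p : E) :
  is_diff p (@xcoord R i) (@xcoord R i).
Proof.
have @l : {linear E -> R}.
  by exists (@xcoord R i); do 2![eexists]; do ?[constructor];
    rewrite /xcoord ?mxE// => ? *; rewrite ?mxE//; move=> ?; rewrite !mxE.
apply: DiffDef; first exact: differentiable_coord.
rewrite (_ : xcoord i = l) //; apply: diff_lin; exact: coord_continuous.
Qed.

(** All coefficients that occur, of J as well as of the forms alpha_{s,t}, are of
    this shape, and the shape is stable under directional derivatives: this
    gives smoothness by induction and one formula for every derivative. *)
Definition affine_exp (a b s t : R) : E -> R := fun p =>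
  (a + b * xcoord ix2 p) * expR (s * xcoord ix1 p + t * xcoord iy1 p).

Lemma is_diff_affine_exp a b s t p : is_diff p (affine_exp a b s t)
  (fun v => affine_exp
    (b * xcoord ix2 v + a * (s * xcoord ix1 v + t * xcoord iy1 v))
    (b * (s * xcoord ix1 v + t * xcoord iy1 v)) s t p).
Proof.
have d1 := is_diff_xcoord ix1 p.
have d2 := is_diff_xcoord ix2 p.
have d3 := is_diff_xcoord iy1 p.
pose h := s *: @xcoord R ix1 + t *: @xcoord R iy1.
have dexp : is_diff (h p) expR (fun y => y * expR (h p)).
  have de : differentiable (@expR R) (h p).
    by apply/derivable1_diffP; exact: derivable_expR.
  by apply: DiffDef => //; rewrite diff1E // derive1E derive_val.
have dh : is_diff p h h by exact: is_diffD.
have dl : is_diff p (cst a + b *: @xcoord R ix2) (b *: @xcoord R ix2).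
  by rewrite -[b *: _ in X in is_diff _ _ X]add0r; exact: is_diffD.
have -> : affine_exp a b s t = (cst a + b *: @xcoord R ix2) * (expR \o h) by [].
apply: is_diff_eq; apply/funext => v.
rewrite /affine_exp !fctE /= /h !fctE /cst.
by rewrite /GRing.scale /=; ring.
Qed.

Lemma derive_affine_exp a b s t v p : 'D_v (affine_exp a b s t) p =
  affine_exp (b * xcoord ix2 v + a * (s * xcoord ix1 v + t * xcoord iy1 v))
             (b * (s * xcoord ix1 v + t * xcoord iy1 v)) s t p.
Proof.
have d := is_diff_affine_exp a b s t p.
by rewrite deriveE ?diff_val //; exact: ex_diff.
Qed.

Lemma differentiable_affine_exp a b s t p : differentiable (affine_exp a b s t) p.
Proof. by have [] := is_diff_affine_exp a b s t p. Qed.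

Lemma smooth_affine_exp a b s t : smooth (affine_exp a b s t).
Proof.
move=> k; elim: k a b => [|k IH] a b /=.
  by move=> p; exact/differentiable_continuous/differentiable_affine_exp.
split=> [p|v]; first exact: differentiable_affine_exp.
by under eq_fun do rewrite derive_affine_exp; exact: IH.
Qed.

Lemma affine_exp0 a b p : affine_exp a b 0 0 p = a + b * xcoord ix2 p.
Proof. by rewrite /affine_exp !mul0r addr0 expR0 mulr1. Qed.

End Coefficients.

(** * The almost complex structure *)

Section AlmostComplexStructure.
Variable R : realType.
Local Notation E := 'rV[R]_4.
Local Notation f := (@xcoord R ix2).

Lemma J4E (h : E -> R) p : J4 h p = mx4
  [:: [:: 0; h p; 1; 0]; [:: 0; 0; 0; 1]; [:: -1; 0; 0; - h p]; [:: 0; -1; 0; 0]].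
Proof.
by apply/matrixP; elim/ord4P; elim/ord4P; rewrite !mxE /= ?mxE /=; ring.
Qed.

Lemma almost_complex_J4 : almost_complex (J4 f).
Proof.
split=> [i j|p]; last first.
  rewrite J4E; apply/matrixP; elim/ord4P; elim/ord4P;
  by rewrite mulmx4E !mxE /=; ring.
have [a [b Jab]] : exists a b, forall p, J4 f p i j = a + b * f p.
  elim/ord4P: i; elim/ord4P: j;
  [exists 0, 0 | exists 0, 1 | exists 1, 0 | exists 0, 0 |
   exists 0, 0 | exists 0, 0 | exists 0, 0 | exists 1, 0 |
   exists (-1), 0 | exists 0, 0 | exists 0, 0 | exists 0, (-1) |
   exists 0, 0 | exists (-1), 0 | exists 0, 0 | exists 0, 0];
  by move=> p; rewrite J4E !mxE /=; ring.
rewrite (_ : (fun p => _) = affine_exp a b 0 0); first exact: smooth_affine_exp.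
by apply/funext => p; rewrite Jab affine_exp0.
Qed.

Lemma nonintegrable_J4 : ~ integrable_acs (J4 f).
Proof.
pose X := fun _ : E => xpartial R ix1.
pose Y := fun _ : E => xpartial R ix2.
have smooth_const (v : E) : smooth_mx (fun _ : E => v).
  move=> i j; rewrite (_ : (fun p => _) = affine_exp (v i j) 0 0 0).
    exact: smooth_affine_exp.
  by apply/funext => p; rewrite affine_exp0 mul0r addr0.
(* The y_2 component of N_J(X, Y) is 1 everywhere. *)
move=> /(_ X Y (smooth_const _) (smooth_const _) 0) /matrixP /(_ 0 iy2).
have JX : J_field (J4 f) X = fun p => f p *: xpartial R ix2 + xpartial R iy1.
  apply/funext => p; rewrite /J_field /X /xpartial -rowE; apply/rowP => j.
  by rewrite !mxE /= ?mxE.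
have JY : J_field (J4 f) Y = fun p => xpartial R iy2.
  apply/funext => p; rewrite /J_field /Y /xpartial -rowE; apply/rowP => j.
  by rewrite !mxE /= ?mxE.
have dJX v p : 'D_v (fun p => f p *: xpartial R ix2 + xpartial R iy1) p =
    f v *: xpartial R ix2.
  have d2 := is_diff_xcoord ix2 p.
  have dl : differentiable (fun p : E => f p *: xpartial R ix2 + xpartial R iy1) p.
    exact/differentiableD/differentiable_cst/differentiableZl/ex_diff.
  rewrite derive_mx; last exact: diff_derivable.
  apply/rowP => j; rewrite [LHS]mxE.
  rewrite (_ : (fun q => _) =
    affine_exp (xpartial R iy1 0 j) (xpartial R ix2 0 j) 0 0).
    rewrite derive_affine_exp !mul0r addr0 mulr0 addr0 mulr0 affine_exp0.
    by rewrite mul0r addr0 !mxE mulrC.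
  by apply/funext => q; rewrite affine_exp0 !mxE addrC [X in _ + X]mulrC.
have dcst (w v p : E) : 'D_v (fun _ : E => w) p = 0 by exact: derive_cst.
rewrite /nijenhuis /lie_bracket JX JY /X /Y /J_field !dJX !dcst !subr0 !sub0r.
have f2 : f (xpartial R ix2) = 1 by rewrite /xcoord !mxE.
have f4 : f (xpartial R iy2) = 0 by rewrite /xcoord !mxE.
rewrite f2 f4 scale0r scale1r mulNmx /xpartial -rowE mul0mx J4E !mxE /=.
lra.
Qed.

End AlmostComplexStructure.

(** * The closed anti-invariant forms *)

Section Forms.
Variable R : realType.
Local Notation E := 'rV[R]_4.

Definition minor2 (M : 'M[R]_(2, 4)) (i j : 'I_4) : R :=
  M ord0 i * M ord_max j - M ord0 j * M ord_max i.

(** The alternating bilinear form u beta - v gamma on the tangent space at a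
    point where [f] takes the value [y]. *)
Definition pform (y u v : R) (M : 'M[R]_(2, 4)) : R :=
  u * (minor2 M ix1 ix2 - y * minor2 M ix1 iy1 - minor2 M iy1 iy2)
  - v * (minor2 M ix1 iy2 - minor2 M ix2 iy1).

Lemma alpha_formE (f : E -> R) s t x M
    (h := expR (s * xcoord ix1 x + t * xcoord iy1 x)) :
  alpha_form f s t x M = pform (f x) (t * h) (s * h) M.
Proof.
rewrite /alpha_form /beta_form /gamma_form /dd /fmul /wedge11 /dcoord.
by rewrite !fctE /= !mxE /pform /minor2 /h; ring.
Qed.

Lemma alpha_affine_exp s t M : (fun x => alpha_form (@xcoord R ix2) s t x M) =
  affine_exp (t * (minor2 M ix1 ix2 - minor2 M iy1 iy2)
              - s * (minor2 M ix1 iy2 - minor2 M ix2 iy1))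
             (- t * minor2 M ix1 iy1) s t.
Proof. by apply/funext => x; rewrite alpha_formE /pform /affine_exp; ring. Qed.

Lemma pform_multilinear y u v : multilinear_rows (pform y u v).
Proof.
move=> M B C i b c /rowP Ei /row_matrixP EB /row_matrixP EC.
have oth (N : 'M[R]_(2, 4)) : (forall k, row k (row' i N) = row k (row' i M)) ->
    forall j, N (lift i 0) j = M (lift i 0) j.
  by move=> /(_ 0) /rowP EN j; have := EN j; rewrite !mxE.
move: (oth _ EB) (oth _ EC) => {oth}{}EB {}EC.
have {}Ei j : M i j = b * B i j + c * C i j by have := Ei j; rewrite !mxE.
have e01 : lift ord0 (0 : 'I_1) = ord_max by apply: val_inj.
have e10 : lift ord_max (0 : 'I_1) = ord0 :> 'I_2 by apply: val_inj.
rewrite /pform /minor2; move: Ei EB EC; elim/ord2P: i;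
  rewrite ?e01 ?e10 => Ei EB EC; by rewrite !Ei !EB !EC; ring.
Qed.

Lemma pform_alternating y u v : alternating_rows (pform y u v).
Proof.
move=> M i j nij /rowP Eij.
have E01 k : M ord_max k = M ord0 k.
  have := Eij k; rewrite !mxE; clear Eij; move: nij.
  by elim/ord2P: i; elim/ord2P: j; rewrite ?eqxx.
by rewrite /pform /minor2 !E01; ring.
Qed.

Lemma alpha_diff_form s t : diff_form (alpha_form (@xcoord R ix2) s t).
Proof.
split=> [x|x|M]; last by rewrite alpha_affine_exp; exact: smooth_affine_exp.
  move=> A B C i b c rA rB rC; rewrite !alpha_formE.
  exact: pform_multilinear rA rB rC.
by move=> A i j nij rA; rewrite alpha_formE; exact: pform_alternating nij rA.
Qed.

Lemma alpha_anti_invariant (f : E -> R) s t :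
  J_anti_invariant (J4 f) (alpha_form f s t).
Proof.
move=> x M; rewrite !alpha_formE J4E /pform /minor2 !mulmx4E !mxE /=; ring.
Qed.

Lemma alpha_closed s t : s ^+ 2 + t ^+ 2 + t = 0 ->
  closed_form (alpha_form (@xcoord R ix2) s t).
Proof.
move=> st0; apply/funext => x; apply/funext => M; rewrite /ext_d.
under eq_bigr do rewrite alpha_affine_exp derive_affine_exp.
rewrite !big_ord_recl big_ord0 /= /affine_exp /minor2 /xcoord !mxE /=.
pose N (i : nat) (j : 'I_4) := M (inord i) j.
have MN (i : 'I_3) j : M i j = N i j by rewrite /N inord_val.
rewrite !MN /= /bump /=; set e := expR _.
(* The last factor is the value of dx_1 /\ dx_2 /\ dy_1 on the rows of M. *)
apply: (@eq_trans _ _ ((s ^+ 2 + t ^+ 2 + t) * e *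
  (N 0%N ix1 * (N 1%N ix2 * N 2%N iy1 - N 1%N iy1 * N 2%N ix2)
   - N 0%N ix2 * (N 1%N ix1 * N 2%N iy1 - N 1%N iy1 * N 2%N ix1)
   + N 0%N iy1 * (N 1%N ix1 * N 2%N ix2 - N 1%N ix2 * N 2%N ix1)))).
  ring.
by rewrite st0 !mul0r.
Qed.

End Forms.

(** * Hermitian metrics and anti-self-duality *)

Section Duality.
Variable R : realType.
Local Notation E := 'rV[R]_4.

(** In the J-complex frame d/dx_2, d/dy_1, whose images under J are d/dy_2 and
    -(d/dx_1 + y d/dy_2), the real inner products of the frame vectors are a, c, d,
    and b is the inner product of d/dy_1 with J(d/dx_2). *)
Definition gram (a b c d y : R) : 'M[R]_4 := mx4
  [:: [:: y ^+ 2 * a + 2 * y * c + d; b; - y * b; - y * a - c];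
      [:: b; a; c; 0];
      [:: - y * b; c; d; b];
      [:: - y * a - c; 0; b; a]].

Lemma inner_delta (g : E -> 'M[R]_4) x i j :
  inner g x (delta_mx 0 i) (delta_mx 0 j) = g x i j.
Proof. by rewrite /inner trmx_delta -rowE -colE !mxE. Qed.

Lemma hermitian_gram (f : E -> R) g x : hermitian_metric (J4 f) g ->
  exists a b c d : R,
    g x = gram a b c d (f x) /\ 0 < a * d - b ^+ 2 - c ^+ 2.
Proof.
move=> [[_ gsym gpos] gJ].
have JgJ i j : (J4 f x *m g x *m (J4 f x)^T) i j = g x i j.
  rewrite -inner_delta -gJ /inner trmx_mul !mulmxA -!rowE.
  rewrite -[RHS]/(((row i (J4 f x) *m g x) *m (J4 f x)^T
                   *m (delta_mx 0 j)^T) 0 0).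
  by rewrite trmx_delta -colE -!row_mul !mxE.
pose G := g x.
have S i j : G j i = G i j by rewrite /G -[in LHS](gsym x) mxE.
pose sE := (S ix1 ix2, S ix1 iy1, S ix1 iy2, S ix2 iy1, S ix2 iy2, S iy1 iy2).
have gE : G = gram (G ix2 ix2) (G ix1 ix2) (G ix2 iy1) (G iy1 iy1) (f x).
  have E11 := JgJ ix1 ix1; have E12 := JgJ ix1 ix2; have E13 := JgJ ix1 iy1.
  have E14 := JgJ ix1 iy2; have E22 := JgJ ix2 ix2; have E24 := JgJ ix2 iy2.
  move: E11 E12 E13 E14 E22 E24; rewrite -/G J4E !mulmx4E !mxE /=.
  rewrite !sE => E11 E12 E13 E14 E22 E24.
  (* Once these two entries are substituted, the equations are linear in the
     monomials that remain. *)
  have G24 : G ix2 iy2 = 0 by lra.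
  rewrite G24 in E11 E12 E13 E14 E22 E24.
  have G34 : G iy1 iy2 = G ix1 ix2 by lra.
  rewrite G34 in E11 E12 E13 E14 E22 E24.
  by apply/matrixP; elim/ord4P; elim/ord4P; rewrite !mxE /= ?sE //; lra.
have a_gt0 : 0 < G ix2 ix2.
  rewrite -inner_delta; apply: gpos; apply/eqP => /rowP /(_ ix2).
  by rewrite !mxE /= => /eqP; rewrite oner_eq0.
exists (G ix2 ix2), (G ix1 ix2), (G ix2 iy1), (G iy1 iy1); split=> //.
move: a_gt0 gE; set a := G ix2 ix2; set b := G ix1 ix2; set c := G ix2 iy1.
set d := G iy1 iy1 => a_gt0 gE.
(* Up to the factor a, u is the component of d/dy_1 orthogonal to the J-complex
   line of d/dx_2; its squared length is a (a d - b^2 - c^2). *)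
pose u : E := \row_j nth 0 [:: 0; - c; a; - b] j.
have : 0 < inner g x u u.
  apply: gpos; apply/eqP => /rowP /(_ iy1); rewrite !mxE /= => a0.
  by rewrite a0 ltxx in a_gt0.
rewrite (_ : inner g x u u = a * (a * d - b ^+ 2 - c ^+ 2)) ?pmulr_rgt0 //.
by rewrite /inner -/G gE !mulmx4E !mxE /=; ring.
Qed.

Definition pform_mx (y u v : R) : 'M[R]_4 := mx4
  [:: [:: 0; u; - (u * y); - v]; [:: - u; 0; v; 0];
      [:: u * y; - v; 0; - u]; [:: v; 0; u; 0]].

(** The Euclidean Hodge dual of [pform_mx]: the entry (i, j) is, up to sign, the
    entry of [pform_mx] at the complementary pair of indices. *)
Definition dual_mx (y u v : R) : 'M[R]_4 := mx4
  [:: [:: 0; - u; 0; v]; [:: u; 0; - v; u * y];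
      [:: 0; v; 0; u]; [:: - v; - (u * y); - u; 0]].

Lemma pform_mxE y u v M :
  pform y u v M = (M *m pform_mx y u v *m M^T) ord0 ord_max.
Proof. by rewrite /pform /minor2 !mulmx4E !mxE /=; ring. Qed.

(** Anti-self-duality with the inverse metric cleared: raising both indices of
    [pform_mx] gives, up to a scalar, its Euclidean dual. *)
Lemma gram_dual (a b c d y u v : R) :
  gram a b c d y *m dual_mx y u v *m gram a b c d y =
  - (a * d - b ^+ 2 - c ^+ 2) *: pform_mx y u v.
Proof.
by apply/matrixP; elim/ord4P; elim/ord4P; rewrite !mulmx4E !mxE /=; ring.
Qed.

Lemma det_gram (a b c d y : R) :
  \det (gram a b c d y) = (a * d - b ^+ 2 - c ^+ 2) ^+ 2.
Proof. by rewrite det4E !mxE /=; ring. Qed.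

Lemma sum_ffun_pairs (F : 'I_4 -> 'I_4 -> R) :
  \sum_(I : {ffun 'I_2 -> 'I_4}) F (I ord0) (I ord_max) = \sum_i \sum_j F i j.
Proof.
rewrite pair_big /=.
rewrite (reindex (fun p : 'I_4 * 'I_4 =>
           [ffun k : 'I_2 => if k == ord0 then p.1 else p.2])) /=.
  by apply: eq_bigr => p _; rewrite !ffunE.
exists (fun I : {ffun 'I_2 -> 'I_4} => (I ord0, I ord_max)) => [[i j] _|I _].
  by rewrite !ffunE.
by apply/ffunP; elim/ord2P; rewrite ffunE.
Qed.

(** Contraction with the volume form of R^4 turns the dual back into [pform];
    each unordered pair of indices is counted twice. *)
Lemma sum_dual_mx (e : (2 + 2 = 4)%N) y u v M :
  \sum_(I : {ffun 'I_2 -> 'I_4}) dual_mx y u v (I ord0) (I ord_max) *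
    \det (castmx (e, erefl 4) (col_mx (rowsub I 1%:M) M)) =
  2 * pform y u v M.
Proof.
pose m (i j k l : 'I_4) : R := (i == k)%:R * (j == l)%:R - (i == l)%:R * (j == k)%:R.
pose F i j := dual_mx y u v i j * (
  m i j ix1 ix2 * minor2 M iy1 iy2 - m i j ix1 iy1 * minor2 M ix2 iy2
  + m i j ix1 iy2 * minor2 M ix2 iy1 + m i j ix2 iy1 * minor2 M ix1 iy2
  - m i j ix2 iy2 * minor2 M ix1 iy1 + m i j iy1 iy2 * minor2 M ix1 ix2).
transitivity (\sum_(I : {ffun 'I_2 -> 'I_4}) F (I ord0) (I ord_max)).
  apply: eq_bigr => I _; rewrite /F /m; congr (_ * _).
  set B := castmx _ _.
  have Bu k l : B (@lshift 2 2 k) l = (I k == l)%:R.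
    by rewrite /B castmx_id [LHS]col_mxEu !mxE.
  have Bd k l : B (@rshift 2 2 k) l = M k l.
    by rewrite /B castmx_id [LHS]col_mxEd.
  have e1 : ix1 = @lshift 2 2 ord0 by apply: val_inj.
  have e2 : ix2 = @lshift 2 2 ord_max by apply: val_inj.
  have e3 : iy1 = @rshift 2 2 ord0 by apply: val_inj.
  have e4 : iy2 = @rshift 2 2 ord_max by apply: val_inj.
  rewrite det4E /minor2 e1 e2 e3 e4.
  by rewrite !Bu !Bd.
by rewrite (sum_ffun_pairs F) !sum4E /F /m !mxE /= /pform /minor2; ring.
Qed.

Lemma hodge_star_pform g x a b c d y u v (e : (2 + 2 = 4)%N) (w : kform R 4 2) M :
  g x = gram a b c d y -> 0 < a * d - b ^+ 2 - c ^+ 2 ->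
  w x = pform y u v -> hodge_star g e w x M = - w x M.
Proof.
set D := a * d - _ - _ => gE D_gt0 wE.
have detg : \det (g x) = D ^+ 2 by rewrite gE det_gram.
have gU : g x \in unitmx by rewrite unitmxE detg unitfE expf_neq0 // gt_eqF.
have invT : (invmx (g x))^T = invmx (g x).
  rewrite trmx_inv gE; congr invmx.
  by apply/matrixP; elim/ord4P; elim/ord4P; rewrite !mxE.
have raise : invmx (g x) *m pform_mx y u v *m invmx (g x) =
    - D^-1 *: dual_mx y u v.
  have /(congr1 (fun A => - D^-1 *: (invmx (g x) *m A *m invmx (g x)))) :=
    gram_dual a b c d y u v.
  rewrite -gE -/D !mulmxA mulVmx // mul1mx -mulmxA mulmxV // mulmx1 => ->.
  by rewrite -scalemxAr -scalemxAl scalerA mulrNN mulVf ?gt_eqF // scale1r.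
rewrite /hodge_star detg sqrtr_sqr gtr0_norm // wE.
transitivity (2^-1 * D * \sum_(I : {ffun 'I_2 -> 'I_4}) (- D^-1) *
   (dual_mx y u v (I ord0) (I ord_max) *
     \det (castmx (e, erefl 4) (col_mx (rowsub I 1%:M) M)))).
  congr (_ * _ * _); apply: eq_bigr => I _; rewrite mulrA; congr (_ * _).
  by rewrite pform_mxE mul_rowsub_mx trmx_mxsub -mxsub_mul invT raise !mxE.
rewrite -mulr_sumr sum_dual_mx; field.
by rewrite gt_eqF.
Qed.

End Duality.

(** * Harmonicity *)

Section Harmonicity.
Variable R : realType.

Lemma ext_d0 n k : ext_d (0 : kform R n k) = 0.
Proof.
apply/funext => x; apply/funext => M; rewrite /ext_d big1 // => i _.
by rewrite [X in _ * X]derive_cst mulr0.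
Qed.

Lemma ext_dN n k (w : kform R n k) : diff_form w -> ext_d (- w) = - ext_d w.
Proof.
move=> [_ _ sw]; apply/funext => x; apply/funext => M.
rewrite /ext_d !fctE -sumrN; apply: eq_bigr => i _; rewrite -mulrN.
rewrite -deriveN //; apply: diff_derivable.
by have [] := sw (row' i M) 1%N.
Qed.

Lemma hodge_star0 n (g : 'rV[R]_n -> 'M[R]_n) k m (e : (k + m = n)%N) :
  hodge_star g e 0 = 0.
Proof.
apply/funext => x; apply/funext => M.
by rewrite /hodge_star big1 ?mulr0 // => I _; rewrite mul0r.
Qed.

(** If w is closed then so is *w = -w; both summands of the Laplacian vanish. *)
Lemma closed_antiselfdual_harmonic (g : 'rV[R]_4 -> 'M[R]_4)
    (e : (2 + 2 = 4)%N) w :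
  diff_form w -> closed_form w -> hodge_star g e w = - w -> laplacian2 g w = 0.
Proof.
move=> dw cw sw; rewrite /laplacian2 /codiff cw.
rewrite (eq_irrelevance (erefl : (2 + 2 = 4)%N) e) sw ext_dN // cw oppr0.
by rewrite !hodge_star0 ext_d0 hodge_star0 !scaler0 ext_d0 addr0.
Qed.

Lemma alpha_harmonic g s t (f := @xcoord R ix2) : hermitian_metric (J4 f) g ->
  s ^+ 2 + t ^+ 2 + t = 0 ->
  harmonic_anti_invariant (J4 f) g (alpha_form f s t).
Proof.
move=> hg st0; split; [exact: alpha_diff_form | exact: alpha_anti_invariant |].
apply: (@closed_antiselfdual_harmonic _ erefl);
  [exact: alpha_diff_form | exact: alpha_closed |].
apply/funext => x; apply/funext => M.
have [a [b [c [d [gE D_gt0]]]]] := hermitian_gram x hg.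
apply: (hodge_star_pform _ _ gE D_gt0).
by apply/funext => N; exact: alpha_formE.
Qed.

End Harmonicity.

(** * Infinite dimension *)

(** If m functions span H, evaluating m+1 elements of H at m+1 points gives a
    matrix that factors through dimension m. *)
Lemma det_evaluation_finite_dimensional (R : realType) (U U' : Type)
    (H : set (U -> U' -> R)) :
  finite_dimensional H ->
  exists m, forall (a : 'I_m.+1 -> U -> U' -> R) (x : 'I_m.+1 -> U) (y : U'),
    (forall i, H (a i)) -> \det (\matrix_(i, j) a i (x j) y) = 0.
Proof.
move=> [m [b [_ span]]]; exists m => a x y Ha.
have /boolp.choice[c ac] i : exists c : 'I_m -> R, a i = \sum_j c j *: b j.
  exact: span.
apply/eqP/negPn/negP => det0.
have : (\rank (\matrix_(i, j) a i (x j) y) <= m)%N.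
  rewrite (_ : \matrix_(i, j) _ =
             (\matrix_(i, k) c i k) *m (\matrix_(k, j) b k (x j) y)).
    by rewrite (leq_trans (mxrankM_maxl _ _)) ?rank_leq_col.
  apply/matrixP => i j; rewrite !mxE ac !fct_sumE; apply: eq_bigr => k _.
  by rewrite !mxE.
by rewrite mxrank_unit ?ltnn // unitmxE unitfE.
Qed.

Lemma infinite_dimensional_harmonic (R : realType) g (f := @xcoord R ix2) :
  hermitian_metric (J4 f) g ->
  ~ finite_dimensional (harmonic_anti_invariant (J4 f) g).
Proof.
move=> hg /det_evaluation_finite_dimensional[m detE0].
(* On the circle s^2 + t^2 + t = 0, t ranges over [-1, 0]. *)
pose t (i : 'I_m.+1) : R := - (i.+2%:R)^-1.
pose s i := Num.sqrt (- t i - t i ^+ 2).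
have t_neq0 i : t i != 0 by rewrite oppr_eq0 invr_neq0 // pnatr_eq0.
have st0 i : s i ^+ 2 + t i ^+ 2 + t i = 0.
  rewrite sqr_sqrtr; first by ring.
  rewrite /t sqrrN opprK subr_ge0 expr2 ler_piMl ?invr_ge0 //.
  by rewrite invf_le1 ?ler1n ?ltr0n.
pose p (j : 'I_m.+1) : 'rV[R]_4 := j%:R *: xpartial R iy1.
(* The rows of M are the tangent vectors d/dy_1 and d/dy_2. *)
pose M : 'M[R]_(2, 4) := \matrix_(i, j)
  ((i == ord0) && (j == iy1) || (i == ord_max) && (j == iy2))%:R.
have := detE0 (fun i => alpha_form f (s i) (t i)) p M
          (fun i => alpha_harmonic hg (st0 i)).
have -> : \matrix_(i, j) alpha_form f (s i) (t i) (p j) M =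
   diag_mx (\row_i - t i) *m (Vandermonde m.+1 (\row_i expR (t i)))^T.
  apply/matrixP => i j.
  rewrite mul_diag_mx !mxE alpha_formE /pform /minor2 /xcoord !mxE /=.
  have -> : s i * (j%:R * 0) + t i * (j%:R * 1) = t i * j%:R by ring.
  by rewrite expRM_natr; ring.
rewrite det_mulmx det_diag det_tr det_Vandermonde => /eqP; rewrite mulf_eq0.
case/orP => /prodf_eq0.
  by case=> i _; rewrite mxE oppr_eq0 (negPf (t_neq0 i)).
case=> i _ /prodf_eq0[j ij].
rewrite !mxE subr_eq0 => /eqP /expR_inj /oppr_inj /invr_inj /eqP.
by rewrite eqr_nat => /eqP[eij]; rewrite eij ltnn in ij.
Qed.

Theorem theorem3p7 (R : realType) (f : 'rV[R]_4 -> R) (g : 'rV[R]_4 -> 'M[R]_4)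
    (hf : f = xcoord ix2)
    (hg : hermitian_metric (J4 f) g) :
  [/\ almost_complex (J4 f) /\ ~ integrable_acs (J4 f),
      (forall s t : R, s ^+ 2 + t ^+ 2 + t = 0 ->
        [/\ diff_form (alpha_form f s t),
            J_anti_invariant (J4 f) (alpha_form f s t)
          & closed_form (alpha_form f s t)])
    & ~ finite_dimensional (harmonic_anti_invariant (J4 f) g)].
Proof.
subst f; split; first by split; [exact: almost_complex_J4 | exact: nonintegrable_J4].
  move=> s t st0; split; [exact: alpha_diff_form | exact: alpha_anti_invariant |].
  exact: alpha_closed.
exact: infinite_dimensional_harmonic.
Qed.
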